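(* Let $s$ be a border router of an AS with IGP graph $G$, and let $p$ be an external prefix whose known BGP routes are advertised by a finite set $N$ of gateways (BGP next-hops), which are nodes of $G$ distinct from $s$. Let $M_1, M_2, \ldots, M_k$ be the sequence of MED-aware rounded (MR) sets of $p$, listed in decreasing order of preference. Suppose that for some index $y\in\{1,\dots,k\}$ there exist two node-disjoint paths from $s$ towards $p$ passing through $\bigcup_{i=1}^{y} M_i$, let $x$ be the minimal such index, and let $$O=\bigcup_{i=1}^{x} M_i$$ (the Optimal-Protecting Rounded set, or OPR set, of $p$). Then $O$ optimally protects $p$. That is, for every single IGP change $c$: (i) $O$ contains the best BGP next-hop of $s$ towards $p$ before $c$ occurs; (ii) $O$ contains the best BGP next-hop of $s$ towards $p$ after $c$ occurs.
   Context: **IGP graph.** $G=(V,E,w)$ is a finite graph with positive link weights (a link may be usable in one or both directions). Its nodes include the router $s$ from whose point of view decisions are made, the other routers of the AS, and the gateways $N\subseteq V\setminus\{s\}$. A gateway is by default the external next-hop router of a neighboring AS. For $n\in N$, $\alpha(n)\in[0,\infty]$ is the shortest-path distance from $s$ to $n$ in the current graph. The gateway $n$ is reachable if $\alpha(n)<\infty$. **Routes.** Each $n\in N$ advertises one route towards $p$, identified with $n$. The route carries inter-domain attributes that do not depend on the IGP and that no IGP change modifies: - the triple $\beta(n)=(\text{local-pref},\ \text{AS-path length},\ \text{origin})$, where triples are totally ordered lexicographically (highest local-pref, then shortest AS-path, then lowest origin is preferred); - the neighboring AS $\mathrm{as}(n)$ from which the route originates; - a MED value $\mathrm{med}(n)$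 (lower is better), which is used only to compare routes originating from the same AS. It also carries a router id, used as a final tie-break. **Best BGP next-hop (decision process).** In a given state of the IGP graph, consider only the reachable gateways of $N$. 1. Keep those whose $\beta$ is most preferred. 2. Among these, for each neighboring AS, discard those whose MED is not the lowest among the kept gateways of that AS. 3. Among the remaining ones, keep those with lowest $\alpha$. 4. Choose the one with the lowest router id. The result is the best BGP next-hop of $s$ towards $p$ in that state. It exists whenever some gateway of $N$ is reachable. **MR sets.** The MED-aware rounded sets of $p$ are the equivalence classes of $N$ under the relation $\beta(n)=\beta(n')$ (MED excluded). They are listed as $M_1,\dots,M_k$ from the most preferred $\beta$ to the least preferred. They depend neither on $\alpha$ nor on the IGP graph. **Node-disjoint paths towards $p$ through a set $A\subseteq N$.** Let $G'$ be obtained from $G$, in its state before the change, by adding a virtual node representing $p$ and connecting every gateway of $A$ to it by a link from the gateway to $p$ (no other node is connected to $p$). Two node-disjoint paths from $s$ towards $p$ passing through $A$ are two paths from $s$ to $p$ in $G'$ that share no node other than $s$ and $p$. **IGP change.** A single IGP change $c$ is one of the following modifications of $G$: the failure (deletion) of one link; the failure of one node other than $s$ (all its incident links are deleted; the node may be a gateway); the insertion of one link or of one non-gateway node with its incident links; a change of the weight of one link to another finite positive value, or of the weights of the links incident to one node. The set of routes known for $p$ and their inter-domain attributes are unchanged by $c$ (the addition of a gateway is a BGP event, not an IGP change); only reachability and the distances $\alpha$ may change. *)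

(* Defs.v *)
From HB Require Import structures.
From mathcomp Require Import all_boot all_order all_algebra.
From mathcomp Require Import boolp classical_sets reals constructive_ereal ereal.

Set Implicit Arguments.
Unset Strict Implicit.
Unset Printing Implicit Defensive.

Import Order.TTheory GRing.Theory Num.Theory.
Local Open Scope ring_scope.
Local Open Scope set_scope.

(* A link is usable from [src] to [dst] and, when [twoway] holds, also from
   [dst] to [src]; it is one object, so both directions fail together. *)
Record link (R : realType) (T : finType) := Link {
  src : T;
  dst : T;
  twoway : bool;
  weight : R
}.

(* [T] and [L] are finite universes of node names and link names; the graph has
   the nodes [nodes] and the links [links], and [lk e] is meaningful only for
   [e \in links].  Names outside these sets are free for insertions.  Naming the
   links allows (but does not require) parallel links. *)
Record igp_graph (R : realType) (T L : finType) := Graph {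
  nodes : {set T};
  links : {set L};
  lk : L -> link R T
}.

Section Links.
Variables (R : realType) (T : finType).
Implicit Types (l : link R T) (u v : T).

Definition incident l v : bool := (src l == v) || (dst l == v).

Definition traverses l u v : bool :=
  ((src l == u) && (dst l == v)) || [&& twoway l, dst l == u & src l == v].

Definition valid_link (V : {set T}) l : bool :=
  [&& src l \in V, dst l \in V & 0 < weight l].

Definition set_weight l (w : R) : link R T := Link (src l) (dst l) (twoway l) w.

End Links.

Section Paths.
Variables (R : realType) (T L : finType).
Implicit Types (g : igp_graph R T L) (u v : T) (p : seq (L * T)).

Definition well_formed g : Prop := {in links g, forall e, valid_link (nodes g) (lk g e)}.

(* A walk from [u] is the list of its hops: link taken, node reached. *)
Fixpoint is_walk g u p : bool :=
  if p is (e, v) :: q then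
    [&& e \in links g, traverses (lk g e) u v & is_walk g v q]
  else true.

Definition path_nodes u p : seq T := u :: unzip2 p.

Definition is_path g u v p : bool :=
  [&& is_walk g u p, uniq (path_nodes u p) & last u (unzip2 p) == v].

Definition path_length g p : R := \sum_(h <- p) weight (lk g h.1).

(* Equal to +oo when there is no path. *)
Definition alpha g u v : \bar R :=
  ereal_inf [set (path_length g p)%:E | p in [set p | is_path g u v p]]%classic.

End Paths.

(* [as_nb n] is the neighboring AS of the route advertised by [n]. *)
Record routes (T : finType) := Routes {
  gateways : {set T};
  local_pref : T -> nat;
  as_path_len : T -> nat;
  origin : T -> nat;
  as_nb : T -> nat;
  med : T -> nat;
  router_id : T -> nat
}.

(* Ordered lexicographically with the local-pref order reversed: a smaller
   triple is a more preferred one. *)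
Definition pref_triple := (nat^d *l (nat *l nat))%type.

Section Bgp.
Variables (R : realType) (T L : finType).
Implicit Types (g : igp_graph R T L) (s : T) (r : routes T).

Definition beta r (n : T) : pref_triple := (local_pref r n, (as_path_len r n, origin r n)).

Definition reachable g s r : {set T} :=
  [set n in gateways r | (alpha g s n < +oo)%E].

Definition best_beta g s r : {set T} :=
  [set n in reachable g s r | [forall m in reachable g s r, (beta r n <= beta r m)%O]].

Definition lowest_med g s r : {set T} :=
  [set n in best_beta g s r |
    [forall m in best_beta g s r, (as_nb r m == as_nb r n) ==> (med r n <= med r m)%N]].

Definition lowest_alpha g s r : {set T} :=
  [set n in lowest_med g s r |
    [forall m in lowest_med g s r, (alpha g s n <= alpha g s m)%E]].

Definition best_nexthop g s r : option T :=
  [pick n in lowest_alpha g s r |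
    [forall m in lowest_alpha g s r, (router_id r n <= router_id r m)%N]].

Definition mr_before r (A B : {set T}) : bool :=
  [forall a in A, forall b in B, (beta r a <= beta r b)%O].

Definition mr_sets r : seq {set T} :=
  sort (mr_before r) (enum (preim_partition (beta r) (gateways r))).

Definition mr_union r (y : nat) : {set T} :=
  (\bigcup_(A <- take y (mr_sets r)) A)%SET.

(* [None] is the virtual node for the prefix, [inr n] the virtual link from the
   gateway [n] to it.  The weight of virtual links plays no role. *)
Definition virtual_graph g (A : {set T}) : igp_graph R (option T) (L + T)%type :=
  Graph (None |: [set Some v | v in nodes g])
        ([set inl e | e in links g] :|: [set inr n | n in A])
        (fun h => match h with
                  | inl e => Link (Some (src (lk g e))) (Some (dst (lk g e)))
                                  (twoway (lk g e)) (weight (lk g e))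
                  | inr n => Link (Some n) None false 1
                  end).

Definition node_disjoint_paths g s (A : {set T}) : Prop :=
  exists p1 p2 : seq ((L + T) * option T),
    [/\ p1 != p2,
        is_path (virtual_graph g A) (Some s) None p1,
        is_path (virtual_graph g A) (Some s) None p2
      & forall v, v \in path_nodes (Some s) p1 -> v \in path_nodes (Some s) p2 ->
          v = Some s \/ v = None].

Definition is_opr_index g s r (x : nat) : Prop :=
  [/\ (1 <= x <= size (mr_sets r))%N,
      node_disjoint_paths g s (mr_union r x)
    & forall y, (1 <= y <= size (mr_sets r))%N ->
        node_disjoint_paths g s (mr_union r y) -> (x <= y)%N].

(* A failed node stays in [nodes], isolated.  Gateways are nodes of the graph,
   so a newly inserted node is never a gateway. *)
Inductive igp_change g s : igp_graph R T L -> Prop :=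
| LinkFailure e :
    e \in links g ->
    igp_change g s (Graph (nodes g) (links g :\ e) (lk g))
| NodeFailure v :
    v \in nodes g -> v != s ->
    igp_change g s
      (Graph (nodes g) [set e in links g | ~~ incident (lk g e) v] (lk g))
| LinkInsertion e (l : link R T) :
    e \notin links g -> valid_link (nodes g) l ->
    igp_change g s
      (Graph (nodes g) (e |: links g) (fun f => if f == e then l else lk g f))
| NodeInsertion v (F : {set L}) (new : L -> link R T) :
    v \notin nodes g -> [disjoint F & links g] ->
    {in F, forall e, incident (new e) v && valid_link (v |: nodes g) (new e)} ->
    igp_change g s
      (Graph (v |: nodes g) (F :|: links g)
             (fun e => if e \in F then new e else lk g e))
| LinkWeightChange e (w : R) :
    e \in links g -> 0 < w ->
    igp_change g s
      (Graph (nodes g) (links g)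
             (fun f => if f == e then set_weight (lk g f) w else lk g f))
| NodeWeightChange v (w : L -> R) :
    v \in nodes g ->
    {in links g, forall e, incident (lk g e) v -> 0 < w e} ->
    igp_change g s
      (Graph (nodes g) (links g)
             (fun e => if incident (lk g e) v then set_weight (lk g e) (w e)
                       else lk g e)).

Definition contains_best g s r (O : {set T}) : Prop :=
  exists2 n, best_nexthop g s r = Some n & n \in O.

Definition optimally_protects g s r (O : {set T}) : Prop :=
  forall g', igp_change g s g' -> contains_best g s r O /\ contains_best g' s r O.

End Bgp.

(* Main.v *)
(** A node other than [s] lies on at most one of two node-disjoint paths, and a
    link used by a path has an endpoint other than [s] on that path.  Hence no
    single failure breaks both paths, and the gateway ending the surviving one is
    a reachable element of [O].  Since [O] is closed under passing to a more
    preferred [beta], it then contains every gateway that survives the first step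
    of the decision process, in particular the best next-hop.  The other changes
    keep all existing paths and only affect their lengths. *)

Require Import Defs.
From mathcomp Require Import all_boot all_order all_algebra reals.
From mathcomp Require Import constructive_ereal ereal.

Set Implicit Arguments.
Unset Strict Implicit.
Unset Printing Implicit Defensive.

Import Order.TTheory.
Local Open Scope set_scope.

(** Each step of the decision process keeps minimisers of some key, so this is what makes every step
    leave a gateway. *)
Lemma exists_min_in (T : finType) d (D : orderType d) (f : T -> D) (A : {set T}) (a : T) :
  a \in A -> exists2 m, m \in A & [forall k in A, (f m <= f k)%O].
Proof.
move=> aA; case: (Order.TotalTheory.arg_minP f aA) => m mA mP.
by exists m => //; apply/forall_inP.
Qed.

(** * Order and closure of the MR sets *)

Section MrSets.
Variables (T : finType) (r : routes T).
Local Notation N := (gateways r).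
Local Notation blocks := (preim_partition (beta r) N).

Lemma mr_blocks_partition : finset.partition blocks N.
Proof. exact: preim_partitionP. Qed.

Lemma block_memE (B : {set T}) a b :
  B \in blocks -> a \in B -> b \in N -> (b \in B) = (beta r a == beta r b).
Proof.
move=> BP aB bN; case/and3P: mr_blocks_partition => /eqP cP tP _.
rewrite -{1}(def_pblock tP BP aB) pblock_equivalence_partition //.
- by move=> x y z _ _ _; split => //= /eqP ->.
- by rewrite -cP; apply/bigcupP; exists B.
Qed.

Lemma block_subset_gateways (B : {set T}) : B \in blocks -> B \subset N.
Proof.
by move=> BP; case/and3P: mr_blocks_partition => /eqP <- _ _; apply: bigcup_sup.
Qed.

Lemma block_same_beta (B : {set T}) a b :
  B \in blocks -> a \in B -> b \in B -> beta r a = beta r b.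
Proof.
move=> BP aB bB; apply/eqP; rewrite -(block_memE BP aB) //.
exact: subsetP (block_subset_gateways BP) _ bB.
Qed.

Lemma block_inhabited (B : {set T}) : B \in blocks -> exists a, a \in B.
Proof.
move=> BP; case/and3P: mr_blocks_partition => _ _ n0.
by apply/set0Pn; apply: contraNneq n0 => <-.
Qed.

Lemma mr_before_blocks (A B : {set T}) a b :
  A \in blocks -> B \in blocks -> a \in A -> b \in B ->
  mr_before r A B = (beta r a <= beta r b)%O.
Proof.
move=> AP BP aA bB; apply/forall_inP/idP => [/(_ a aA)/forall_inP/(_ b bB) //|ab c cA].
apply/forall_inP => e eB.
by rewrite (block_same_beta AP cA aA) (block_same_beta BP eB bB).
Qed.

(** On arbitrary sets [mr_before] is neither total nor transitive: the empty set is related to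
    everything, and sets with mixed [beta] may be incomparable. On blocks it reduces to comparing
    the [beta] of any two representatives, so sorting is correct there. *)
Lemma mr_sets_pairwise : pairwise (mr_before r) (mr_sets r).
Proof.
have aP : all [in blocks] (enum blocks) by apply/allP => B; rewrite mem_enum.
have tot : {in blocks &, total (mr_before r)}.
  move=> A B AP BP; have [a aA] := block_inhabited AP; have [b bB] := block_inhabited BP.
  by rewrite (mr_before_blocks AP BP aA bB) (mr_before_blocks BP AP bB aA) le_total.
have tr : {in blocks & &, transitive (mr_before r)}.
  move=> B A C BP AP CP.
  have [a aA] := block_inhabited AP; have [b bB] := block_inhabited BP.
  have [c cC] := block_inhabited CP.
  rewrite (mr_before_blocks AP BP aA bB) (mr_before_blocks BP CP bB cC).
  by rewrite (mr_before_blocks AP CP aA cC); apply: le_trans.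
rewrite /mr_sets -(sorted_pairwise_in tr) ?all_sort //.
exact: sort_sorted_in tot _ aP.
Qed.

Lemma mem_mr_sets (B : {set T}) : (B \in mr_sets r) = (B \in blocks).
Proof. by rewrite mem_sort mem_enum. Qed.

Lemma mr_unionP y a :
  reflect (exists2 A, A \in take y (mr_sets r) & a \in A) (a \in mr_union r y).
Proof.
rewrite /mr_union; elim: (take _ _) => [|B l IH].
  by rewrite big_nil inE; constructor=> -[].
rewrite big_cons inE; apply: (iffP orP) => [[aB|/IH[A Al aA]]|[A]].
- by exists B; rewrite ?mem_head.
- by exists A; rewrite // inE Al orbT.
- rewrite inE => /orP[/eqP->|Al aA]; first by left.
  by right; apply/IH; exists A.
Qed.

Lemma mr_union_subset_gateways y : mr_union r y \subset N.
Proof.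
apply/subsetP => a /mr_unionP[A /mem_take]; rewrite mem_mr_sets => AP aA.
exact: subsetP (block_subset_gateways AP) _ aA.
Qed.

(** If the block of [b] came after the first [y], sortedness would give the converse comparison. The
    two [beta] are then equal, and that block is the block of [a], which is among the first [y]. *)
Lemma mr_union_closed y a b :
  a \in mr_union r y -> b \in N -> (beta r b <= beta r a)%O -> b \in mr_union r y.
Proof.
move=> /mr_unionP[A Ay aA] bN ba; apply/mr_unionP.
have AP : A \in blocks by rewrite -mem_mr_sets; apply: mem_take Ay.
have : b \in cover blocks by rewrite (cover_partition mr_blocks_partition).
case/bigcupP => B BP bB; exists B => //.
have : B \in mr_sets r by rewrite mem_mr_sets.
rewrite -{1}(cat_take_drop y (mr_sets r)) mem_cat => /orP[//|By].
have := mr_sets_pairwise; rewrite -{1}(cat_take_drop y (mr_sets r)) pairwise_cat.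
case/andP => /allrelP/(_ _ _ Ay By).
rewrite (mr_before_blocks AP BP aA bB) => ab _.
have abE : beta r a = beta r b by apply/le_anti/andP.
have bA : b \in A by rewrite (block_memE AP aA bN) abE.
case/and3P: mr_blocks_partition => _ tP _.
by rewrite -(def_pblock tP BP bB) (def_pblock tP AP bA).
Qed.

End MrSets.

(** * The decision process, then paths towards the prefix and under a change *)

Section Protection.
Variables (R : realType) (T L : finType).
Implicit Types (g : igp_graph R T L) (s : T) (r : routes T).

Lemma alpha_lt_pinfty g u v p : is_path g u v p -> (alpha g u v < +oo)%E.
Proof.
move=> pP; apply: (@Order.POrderTheory.le_lt_trans _ _ (path_length g p)%:E%E).
  by apply: ereal_inf_lbound; exists p.
exact: ltry.
Qed.

(** The later steps only select inside [best_beta], and membership in a union of MR sets depends on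
    [beta] alone, so nothing finer is recorded about [m]. *)
Lemma best_nexthop_exists g s r n :
  n \in reachable g s r -> exists2 m, best_nexthop g s r = Some m & m \in best_beta g s r.
Proof.
case/(exists_min_in (beta r)) => a aR aP.
have {aR aP} aB : a \in best_beta g s r by rewrite inE aR.
(* A gateway of lowest MED overall is in particular lowest within its own neighboring AS. *)
have [b bB bP] := exists_min_in (med r) aB.
have {bB bP} bM : b \in lowest_med g s r.
  rewrite inE bB; apply/forall_inP => k kB; apply/implyP => _.
  exact: (forall_inP bP).
have [c cM cP] := exists_min_in (alpha g s) bM.
have {cM cP} cA : c \in lowest_alpha g s r by rewrite inE cM.
have [d dA dP] := exists_min_in (router_id r) cA.
rewrite /best_nexthop; case: pickP => [m /andP[mA _]|/(_ d)].
  by exists m => //; move: mA; rewrite !inE => /andP[/andP[]].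
by rewrite dA => /negP[].
Qed.

(** The path makes [n] reachable, so the best next-hop is at least as preferred in [beta], and
    closure of the union applies. *)
Lemma contains_best_of_path g s r y n p :
  n \in mr_union r y -> is_path g s n p -> contains_best g s r (mr_union r y).
Proof.
move=> nO pP.
have nR : n \in reachable g s r.
  by rewrite inE (subsetP (mr_union_subset_gateways r y)) //= (alpha_lt_pinfty pP).
have [m mE] := best_nexthop_exists nR.
rewrite inE => /andP[mR /forall_inP mP]; exists m => //.
apply: mr_union_closed nO _ (mP _ nR).
by move: mR; rewrite inE => /andP[].
Qed.

(** Only virtual links enter [None] and no link leaves it, so such a walk is a walk of [g] to an
    element of [A] followed by a single virtual hop. *)
Lemma virtual_walk_to_prefix g (A : {set T}) u p :
  is_walk (virtual_graph g A) (Some u) p -> last (Some u) (unzip2 p) = None ->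
  exists n q, [/\ n \in A, is_walk g u q, last u (unzip2 q) = n
    & path_nodes (Some u) p = rcons (map Some (path_nodes u q)) None].
Proof.
elim: p u => [//|[[e|m] [v|]] p IH] u /=; rewrite ?andbF // /traverses /=.
- case/and3P => eL tr wp lp; have [n [q [nA wq lq pE]]] := IH v wp lp.
  exists n, ((e, v) :: q); split => //=.
    rewrite wq andbT; apply/andP; split.
      move: eL; rewrite !inE => /orP[/imsetP[f fL [->//]]|].
      by case/imsetP.
    by move: tr; rewrite /traverses !(inj_eq Some_inj).
  by rewrite /path_nodes /= in pE *; rewrite pE.
(* A link of [g] cannot enter [None], and, in the next case, a virtual link cannot enter a node of
   [g]. *)
- by case/and3P => _ /orP[/andP[_ /eqP]|/and3P[_ _ /eqP]].
- by case/and3P => _ /orP[/andP[_ /eqP]|].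
- case/and3P => mA /orP[/andP[/eqP[<-] _]|//] wp _.
  exists m, [::]; split => //.
    by move: mA; rewrite !inE => /orP[/imsetP[]|/imsetP[k kA [->]]].
  (* Virtual links are one-way, so no further hop can start from [None]. *)
  case: p wp {IH} => [//|[[e|k] w] p] /=; last by rewrite andbF.
  by case/and3P => _ /orP[/andP[/eqP]|/and3P[_ /eqP]].
Qed.

Lemma virtual_path_to_prefix g s (A : {set T}) p :
  is_path (virtual_graph g A) (Some s) None p ->
  exists n q, [/\ n \in A, is_path g s n q
    & forall v, v \in path_nodes s q -> Some v \in path_nodes (Some s) p].
Proof.
case/and3P => wp up /eqP lp; have [n [q [nA wq lq pE]]] := virtual_walk_to_prefix wp lp.
exists n, q; split => // [|v vq].
  apply/and3P; split; rewrite ?lq //.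
  by move: up; rewrite pE rcons_uniq (map_inj_uniq Some_inj) => /andP[].
by rewrite pE mem_rcons inE map_f ?orbT.
Qed.

Lemma path_avoiding_node g s (A : {set T}) v :
  node_disjoint_paths g s A -> v != s ->
  exists n q, [/\ n \in A, is_path g s n q & v \notin path_nodes s q].
Proof.
case=> p1 [p2 [_ P1 P2 dis]] vs.
have [n1 [q1 [n1A Q1 S1]]] := virtual_path_to_prefix P1.
have [n2 [q2 [n2A Q2 S2]]] := virtual_path_to_prefix P2.
case: (boolP (v \in path_nodes s q1)) => [vq1|]; last by exists n1, q1.
exists n2, q2; split => //; apply/negP => vq2.
by case: (dis _ (S1 _ vq1) (S2 _ vq2)) => // -[/eqP]; apply/negP.
Qed.

(** Used in contrapositive form: a walk missing a node uses no link incident to it. *)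
Lemma walk_hop g u p e v :
  is_walk g u p -> (e, v) \in p ->
  e \in links g /\ forall w, incident (lk g e) w -> w \in path_nodes u p.
Proof.
elim: p u => [//|[f x] p IH] u /= /and3P[fL tr wp].
rewrite inE => /orP[/eqP[-> _]|/(IH _ wp)[eL inc]].
  split=> // w; rewrite /incident /path_nodes /= !inE.
  by case/orP: tr => [/andP[/eqP-> /eqP->]|/and3P[_ /eqP-> /eqP->]];
     case/orP => /eqP->; rewrite eqxx ?orbT.
by split=> // w /inc wx; rewrite /path_nodes inE wx orbT.
Qed.

(** A loop would repeat its node. This settles the failure of a loop at [s], which has no endpoint
    other than [s]. *)
Lemma path_hop_no_loop g u v p e x :
  is_path g u v p -> (e, x) \in p -> src (lk g e) != dst (lk g e).
Proof.
case/and3P => + + _ ep.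
elim: p u ep => [//|[f y] p IH] u ep /= /and3P[_ tr wp] /andP[unotin up].
move: ep; rewrite inE => /orP[/eqP[fE _]|ep]; last exact: (IH y).
apply: contraNneq unotin => de; move: tr; rewrite -fE /traverses de inE.
by case/orP => [/andP[/eqP-> /eqP->]|/and3P[_ /eqP-> /eqP->]]; rewrite eqxx.
Qed.

(** Being a path depends on the presence and directions of its links, not on weights, so only the
    hops of [p] need checking. *)
Lemma path_transfer g g' u v p :
  is_path g u v p ->
  (forall e x, (e, x) \in p -> e \in links g ->
    e \in links g' /\ traverses (lk g' e) =2 traverses (lk g e)) ->
  is_path g' u v p.
Proof.
case/and3P => + up lp tr; rewrite /is_path up lp /= andbT => {up lp}.
elim: p u tr => [//|[e y] p IH] u tr /= /and3P[eL te wp].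
have [-> ->] := tr e y (mem_head _ _) eL.
rewrite te; apply: IH wp => f x fx; apply: (tr f x).
by rewrite inE fx orbT.
Qed.

Lemma path_survives g s (A : {set T}) g' :
  node_disjoint_paths g s A -> igp_change g s g' ->
  exists2 n, n \in A & exists q, is_path g' s n q.
Proof.
move=> dis.
(* Either path will do when no link is removed, or when the failed link is a loop at [s]. *)
have [p1 [_ [_ /virtual_path_to_prefix[n0 [q0 [n0A Q0 _]]] _ _]]] := dis.
case=> [e _|v _ vs|e l eL _|v F new _ FL _|e w _ _|v w _ _].
(* If the failed link has an endpoint other than [s], a path avoiding that endpoint survives;
   otherwise both endpoints are [s]. *)
- have [v /andP[inc vs]|loop] := pickP (fun v => incident (lk g e) v && (v != s)).
    have [n [q [nA Q vq]]] := path_avoiding_node dis vs.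
    exists n => //; exists q; apply: (path_transfer Q) => f x fq fL; split => //.
    rewrite !inE /= fL andbT; apply: contraNneq vq => fe.
    case/and3P: Q => wq _ _; have [_] := walk_hop wq fq.
    by apply; rewrite fe.
  have endpoint v : incident (lk g e) v -> v = s.
    by move=> inc; have := loop v; rewrite inc => /negbFE/eqP.
  exists n0 => //; exists q0; apply: (path_transfer Q0) => f x fq fL; split => //.
  rewrite !inE /= fL andbT; apply: contraNneq (path_hop_no_loop Q0 fq) => ->.
  have -> : src (lk g e) = s by apply: endpoint; rewrite /incident eqxx.
  by apply/eqP/esym/endpoint; rewrite /incident eqxx orbT.
- have [n [q [nA Q vq]]] := path_avoiding_node dis vs.
  exists n => //; exists q; apply: (path_transfer Q) => f x fq fL; split => //.
  rewrite inE /= fL /=; apply: contra vq.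
  by case/and3P: Q => wq _ _; have [_] := walk_hop wq fq; apply.
- exists n0 => //; exists q0; apply: (path_transfer Q0) => f x _ fL /=.
  (* The inserted link has a fresh name, so it does not overwrite a link of the path. *)
  by rewrite !inE fL orbT; split=> //; case: eqP fL eL => // -> ->.
- exists n0 => //; exists q0; apply: (path_transfer Q0) => f x _ fL /=.
  by rewrite inE fL orbT (disjointFl FL fL).
- exists n0 => //; exists q0; apply: (path_transfer Q0) => f x _ fL /=.
  by split=> // a b; case: eqP.
- exists n0 => //; exists q0; apply: (path_transfer Q0) => f x _ fL /=.
  by split=> // a b; case: ifP.
Qed.

End Protection.

Theorem theorem1 (R : realType) (T L : finType) (g : igp_graph R T L) (s : T)
    (r : routes T) (x : nat)
    (hg : well_formed g)
    (hs : s \in nodes g)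
    (hN : gateways r \subset nodes g :\ s)
    (hid : {in gateways r &, injective (router_id r)})
    (hx : is_opr_index g s r x) :
  optimally_protects g s r (mr_union r x).
Proof.
case: hx => _ dis _ g' gg'; split.
  case: dis => p1 [_ [_ /virtual_path_to_prefix[n [q [nO Q _]]] _ _]].
  exact: contains_best_of_path nO Q.
have [n nO [q Q]] := path_survives dis gg'.
exact: contains_best_of_path nO Q.
Qed.
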